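(* The lower density threshold of 2-Visits is at least $\sqrt{2}-1/2\approx 0.9142$ and at most $1$. That is, every 2-Visits instance $D$ with $\mathrm{Dens}(D)\leq\sqrt{2}-1/2$ admits a schedule, and the lower density threshold (the largest $\delta$ such that all instances of density at most $\delta$ admit a schedule) does not exceed $1$.
   Context: 2-Visits: given a multiset of positive integers (deadlines) $D=\{d_1,\ldots,d_n\}$, decide whether there is a sequence of length $2n$ containing each $i\in[n]$ exactly twice, with the first occurrence of $i$ within the first $d_i$ positions and the second at most $d_i$ positions after the first. The density of $D$ is $\mathrm{Dens}(D)=\sum_{i=1}^n 1/d_i$. The lower density threshold of a problem is the largest value $\delta$ such that every instance with density at most $\delta$ admits a schedule. *)

(* Defs.v *)
From mathcomp Require Import all_boot all_order all_algebra.
From mathcomp Require Import classical_sets reals.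

Set Implicit Arguments.
Unset Strict Implicit.
Unset Printing Implicit Defensive.

Import Order.TTheory GRing.Theory Num.Theory.

Local Open Scope classical_set_scope.
Local Open Scope ring_scope.

(* The multiset of deadlines {d_1, ..., d_n} is given by the family of its
   elements, so equal deadlines at distinct indices are distinct tasks. *)
Definition two_visits_instance (n : nat) (d : 'I_n -> nat) : Prop :=
  forall i, (0 < d i)%N.

(* Positions are counted from 1, whereas [index] counts from 0. *)
Definition first_visit (n : nat) (s : seq 'I_n) (i : 'I_n) : nat :=
  (index i s).+1.

Definition second_visit (n : nat) (s : seq 'I_n) (i : 'I_n) : nat :=
  (first_visit s i + first_visit (drop (first_visit s i) s) i)%N.

Definition is_schedule (n : nat) (d : 'I_n -> nat) (s : seq 'I_n) : Prop :=
  [/\ size s = (2 * n)%N,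
      forall i, count_mem i s = 2,
      forall i, (first_visit s i <= d i)%N
    & forall i, (second_visit s i <= first_visit s i + d i)%N].

Definition schedulable (n : nat) (d : 'I_n -> nat) : Prop :=
  exists s : seq 'I_n, is_schedule d s.

Definition density (R : realType) (n : nat) (d : 'I_n -> nat) : R :=
  \sum_(i < n) (d i)%:R^-1.

Definition guarantees_schedule (R : realType) (delta : R) : Prop :=
  forall (n : nat) (d : 'I_n -> nat),
    two_visits_instance d -> density R d <= delta -> schedulable d.

(* [guarantees_schedule] is downward closed in [delta], so this is its largest
   member whenever a largest member exists.  Taking the supremum makes the
   threshold well defined without presupposing that it is attained.  [sup] is 0
   on a set without supremum, so a positive lower bound on the threshold also
   rules out that default value. *)
Definition lower_density_threshold (R : realType) : R :=
  sup [set delta : R | guarantees_schedule delta].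

(* Main.v *)
Require Import Defs.
From mathcomp Require Import all_boot all_order all_algebra.
From mathcomp Require Import classical_sets reals.
From mathcomp Require Import zify ring lra.

Import Order.TTheory GRing.Theory Num.Theory.

(* Sort the deadlines and reserve for each task k the latest slot p k that still
   lets the tasks k, k+1, ... meet their first deadlines; so
   p k = min_(m >= k) (d_m - (m - k)).  The remaining visit of k goes to the k-th
   slot left idle.  It only has to lie at or before p k + d_k: if it comes before
   p k, the two visits exchange roles and both constraints still hold.

   If the first J tasks do not get such slots, and K is the number of slots
   p k <= p (J - 1) + d_(J - 1), then the minima defining p produce L and M with
   J <= L <= K <= M (after enlarging K) such that the first J tasks have deadlines
   at most x, the next L - J at most y and the next M - L at most z, where
   x + y < K + L and z < M + J.  In the extremal case L = K = M, z = y, and writing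
   w = 2 L - y the density is at least w / y + y / (2 w) - 1 / 2, hence at least
   sqrt 2 - 1 / 2 by AM-GM.

   For the upper bound, m + 1 tasks of deadline m have density 1 + 1 / m, and
   their first visits do not fit in m positions. *)

(** * From slot assignments to schedules *)

Local Open Scope nat_scope.

(* Slots count from 0, and [q i] may precede [p i], in which case it is the first
   visit. *)
Lemma schedulable_slots (n : nat) (d : 'I_n -> nat) (p q : 'I_n -> nat) :
  injective p -> injective q -> (forall i j, p i != q j) ->
  (forall i, p i < d i) -> (forall i, q i <= p i + d i) -> schedulable d.
Proof.
move=> pI qI pq pd qd.
pose f t := [pick i | (p i == t) || (q i == t)].
have fE i t : (f t == Some i) = (p i == t) || (q i == t).
  rewrite /f; case: pickP => [j|/(_ i)->//].
  have nqp a b : q a != p b by rewrite eq_sym.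
  case/orP => /eqP <-; rewrite (inj_eq Some_inj) ?(inj_eq pI) ?(inj_eq qI).
    by rewrite (negbTE (nqp _ _)) orbF eq_sym.
  by rewrite (negbTE (pq _ _)) eq_sym.
pose N := \max_i (maxn (p i) (q i)).+1.
have pN i : p i < N /\ q i < N.
  by have := leq_bigmax (F := fun i => (maxn (p i) (q i)).+1) i; rewrite -/N; lia.
pose s := pmap f (iota 0 N).
have cs i (l : seq nat) : count_mem i (pmap f l) = count_mem (p i) l + count_mem (q i) l.
  elim: l => //= t l IH.
  have := fE i t; case: (f t) => [j|] /=; rewrite ?IH.
    rewrite (inj_eq Some_inj) => ->; rewrite [t == p i]eq_sym [t == q i]eq_sym.
    case: (p i =P t) => [pt|_]; case: (q i =P t) => [qt|_] /=; try lia.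
    by have := pq i i; rewrite pt qt eqxx.
  by move/esym/norP => [/negbTE a /negbTE b]; rewrite [t == p i]eq_sym [t == q i]eq_sym a b.
have cN i : count_mem i s = 2.
  by rewrite cs !count_uniq_mem ?iota_uniq // !mem_iota; have [-> ->] := pN i.
exists s.
have split_at i : exists l1 l2, [/\ s = l1 ++ i :: l2,
    i \notin l1, size l1 < d i & exists l3 l4, l2 = l3 ++ i :: l4 /\ size l3 < d i].
  (* The earlier and the later slot of [i]. If [q i < p i], the gap [v - u] is at most
     [p i < d i]. *)
  pose u := minn (p i) (q i); pose v := maxn (p i) (q i).
  have uv : u < v by have := pq i i; rewrite /u /v; lia.
  have [pNi qNi] := pN i.
  have vN : v < N by rewrite /v; lia.
  have sE : iota 0 N = iota 0 u ++ u :: iota u.+1 (v - u.+1) ++ v :: iota v.+1 (N - v.+1).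
    have -> : N = u + (1 + ((v - u.+1) + (1 + (N - v.+1)))) by lia.
    rewrite !iotaD /=; congr (_ ++ _ :: _).
    by rewrite add0n addn1; congr (_ ++ _); rewrite subnKC //= ; congr (_ :: iota _ _); lia.
  have fu : f u = Some i by apply/eqP; rewrite fE /u; case: (leqP (p i) (q i)); rewrite eqxx ?orbT.
  have fv : f v = Some i by apply/eqP; rewrite fE /v; case: (leqP (p i) (q i)); rewrite eqxx ?orbT.
  exists (pmap f (iota 0 u)), (pmap f (iota u.+1 (v - u.+1) ++ v :: iota v.+1 (N - v.+1))).
  split.
  - by rewrite /s sE pmap_cat /= fu.
  - rewrite -has_pred1 has_count cs !count_uniq_mem ?iota_uniq // !mem_iota.
    by rewrite /u; lia.
  - have := pd i.
    by rewrite size_pmap; have := count_size f (iota 0 u); rewrite size_iota /u; lia.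
  - exists (pmap f (iota u.+1 (v - u.+1))), (pmap f (iota v.+1 (N - v.+1))).
    split; first by rewrite pmap_cat /= fv.
    rewrite size_pmap; have := count_size f (iota u.+1 (v - u.+1)); rewrite size_iota.
    by have := pd i; have := qd i; rewrite /u /v in uv *; lia.
have fvE (i : 'I_n) l1 l2 : i \notin l1 -> first_visit (l1 ++ i :: l2) i = (size l1).+1.
  by move=> h; rewrite /first_visit index_cat (negbTE h) /= eqxx addn0.
split=> // [|i|i].
- rewrite -sum1_size (partition_big id xpredT) //=.
  rewrite (eq_bigr (fun=> 2)) => [|i _]; last by rewrite sum1_count -[RHS](cN i).
  by rewrite sum_nat_const card_ord mulnC.
- by have [l1 [l2 [-> h lu _]]] := split_at i; rewrite fvE.
- have [l1 [l2 [-> h _ [l3 [l4 [-> l3d]]]]]] := split_at i.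
  rewrite /second_visit fvE // leq_add2l -cat_rcons drop_size_cat ?size_rcons //.
  rewrite /first_visit index_cat; case: ifP => [|_] /=; last by rewrite eqxx addn0.
  by rewrite -index_mem => il3; apply: leq_trans il3 (ltnW l3d).
Qed.

(** * Reserved and idle slots *)

(** Slots count from 1 here, and the bounds are additive to avoid truncated subtraction. Where [m]
    attains the minimum defining [p k], tasks [k] to [m] fill consecutive slots ending at [e m]. *)
Lemma latest_slots (n : nat) (e : nat -> nat) :
  (forall k, k < n -> k < e k) ->
  exists p : nat -> nat, [/\ forall i j, i < j < n -> p i < p j,
    forall k, k < n -> 0 < p k,
    forall k m, k <= m < n -> p k + m <= e m + k &
    forall k, k < n -> exists2 m, k <= m < n & p k + m = e m + k].
Proof.
move=> he.
pose P k v := (k < n) ==> [exists m : 'I_n, (k <= m) && (v + m == e m + k)].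
have exP k : exists v, P k v.
  exists (e k); apply/implyP => kn; apply/existsP; exists (Ordinal kn) => /=.
  by rewrite leqnn eqxx.
pose p k := ex_minn (exP k).
have tight k : k < n -> exists2 m, k <= m < n & p k + m = e m + k.
  rewrite /p; case: ex_minnP => v /implyP h _ kn.
  have /existsP[m /andP[km /eqP]] := h kn.
  by exists m; rewrite // km ltn_ord.
have low k m : k <= m < n -> p k + m <= e m + k.
  case/andP => km mn; have em := he m mn.
  rewrite /p; case: ex_minnP => v _ /(_ (e m + k - m)) h.
  suff: P k (e m + k - m) by move/h; lia.
  apply/implyP => _; apply/existsP; exists (Ordinal mn) => /=.
  by rewrite km /=; apply/eqP; lia.
exists p; split=> // [i j ijn|k kn].
  have [|m mn pm] := tight j; first lia.
  by have := low i m; have := he m; lia.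
have [m mn pm] := tight k kn.
by have := he m; lia.
Qed.

(** Take for [q j] the least [t] satisfying the counting inequality. When [p] is injective, that
    inequality says that at least [j + 1] of the slots 1 to [t] are idle, so [q j] is the idle slot
    of rank [j]. *)
Lemma idle_slots (n : nat) (p e : nat -> nat) :
  (forall k, k < n -> 0 < p k) ->
  (forall j, j < n -> j.+1 + \sum_(k < n | p k <= e j) 1 <= e j) ->
  exists q : nat -> nat, [/\ forall i j, i < n -> j < n -> q i = q j -> i = j,
    forall i j, i < n -> j < n -> p i != q j,
    forall k, k < n -> 0 < q k &
    forall k, k < n -> q k <= e k].
Proof.
move=> p0 he.
pose P j t := (j < n) ==> (j.+1 + \sum_(k < n | p k <= t) 1 <= t).
have exP j : exists t, P j t by exists (e j); apply/implyP; apply: he.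
pose q j := ex_minn (exP j).
have qP j : j < n -> j.+1 + \sum_(k < n | p k <= q j) 1 <= q j.
  by move=> jn; rewrite /q; case: ex_minnP => t /implyP h _; apply: h.
have qmin j t : j.+1 + \sum_(k < n | p k <= t) 1 <= t -> q j <= t.
  by move=> h; rewrite /q; case: ex_minnP => v _; apply; apply/implyP.
have mono t : \sum_(k < n | p k <= t.-1) 1 <= \sum_(k < n | p k <= t) 1.
  rewrite big_mkcond [X in _ <= X]big_mkcond /=; apply: leq_sum => k _.
  by case: ifP => // h; rewrite ifT //; lia.
have lt_inj i j : i < j -> i < n -> j < n -> q i = q j -> False.
  move=> ij iN jN E; have := qP _ jN; have := qmin i (q j).-1.
  by have := mono (q j); lia.
exists q; split=> // [i j iN jN E|i j iN jN|k kN|k kN].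
- by case: (ltngtP i j) => // ij; [case: (lt_inj i j)|case: (lt_inj j i)].
(* If [q j] were some [p i], stepping back one slot would also lower the count, so the inequality
   would hold earlier, against minimality. *)
- apply/eqP => E; have := qP _ jN; have := qmin j (q j).-1.
  rewrite -E; suff : \sum_(k < n | p k <= (p i).-1) 1 < \sum_(k < n | p k <= p i) 1.
    by have := p0 i iN; lia.
  rewrite [X in _ < X](bigD1 (Ordinal iN)) //= add1n ltnS.
  rewrite big_mkcond [X in _ <= X]big_mkcond /=; apply: leq_sum => k _.
  case: ifP => // h; rewrite ifT //; have := p0 i iN => pi0.
  have ki : nat_of_ord k != i by apply/eqP => ki; move: h; rewrite ki; lia.
  by rewrite -val_eqE /= ki andbT; lia.
- by have := qP _ kN; lia.
- by apply: qmin; apply: he.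
Qed.

(** * Density inequalities *)

Local Open Scope ring_scope.

Lemma sqrt2_sub_half_lt1 (R : realType) : Num.sqrt 2 - 1 / 2 < 1 :> R.
Proof.
have s0 : 0 <= Num.sqrt 2 :> R by apply: sqrtr_ge0.
have ss : Num.sqrt 2 * Num.sqrt 2 = 2 :> R by rewrite -expr2 sqr_sqrtr.
nra.
Qed.

(** This is where the constant arises: AM-GM would be tight at [D = sqrt 2 * w] with
    [w = 2 * L - D], and [x < w] makes the bound strict. *)
Lemma two_block_density (R : realType) (J L x D : R) :
  0 < J -> 0 < x -> x <= D -> J <= L -> x + D < 2 * L -> D <= L + J ->
  Num.sqrt 2 - 1 / 2 < J / x + (L - J) / D.
Proof.
move=> J0 x0 xD JL xDL DLJ.
have D0 : 0 < D by lra.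
have [DL|LD] := leP D L.
  apply: (lt_le_trans (sqrt2_sub_half_lt1 R)).
  have h1 : J / D <= J / x by rewrite ler_pM2l // lef_pV2.
  have h2 : 1 <= L / D by rewrite ler_pdivlMr // mul1r.
  have : J / D + (L - J) / D = L / D by rewrite -mulrDl addrC subrK.
  lra.
set w := 2 * L - D.
have xw : x < w by rewrite /w; lra.
have w0 : 0 < w by lra.
have LE : L = (D + w) / 2 by rewrite /w; field.
have JE : (D - w) / 2 <= J by rewrite /w; lra.
have wD : w < D by rewrite /w; lra.
have h1 : J / w < J / x by rewrite ltr_pM2l // ltf_pV2.
have h2 : 0 <= (J - (D - w) / 2) * (D - w) / (w * D).
  by apply: divr_ge0; [apply: mulr_ge0; lra | apply: mulr_ge0; lra].
(* J / w + (L - J) / D increases with J, and J = (D - w) / 2 gives the AM-GM bound *)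
have h3 : J / w + (L - J) / D
    = D / (2 * w) + w / D - 1 / 2 + (J - (D - w) / 2) * (D - w) / (w * D).
  by rewrite LE; field; rewrite !lt0r_neq0.
have ss : Num.sqrt 2 * Num.sqrt 2 = 2 :> R by rewrite -expr2 sqr_sqrtr.
have h4 : D / (2 * w) + w / D
    = Num.sqrt 2 + (D - Num.sqrt 2 * w) ^+ 2 / (2 * w * D).
  have -> : (D - Num.sqrt 2 * w) ^+ 2 = D ^+ 2 - 2 * Num.sqrt 2 * (w * D) + 2 * w ^+ 2.
    by rewrite sqrrB exprMn (expr2 (Num.sqrt 2)) ss; ring.
  by field; rewrite !lt0r_neq0.
have h5 : 0 <= (D - Num.sqrt 2 * w) ^+ 2 / (2 * w * D).
  by apply: divr_ge0; [exact: sqr_ge0 | rewrite !mulr_ge0 // ltW].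
lra.
Qed.

(** Depending on [y], the last two blocks merge into one and the two-block bound applies, or the
    density is at least 1. *)
Lemma three_block_density (R : realType) (J L K M x y z : R) :
  0 < J -> J <= L -> L <= K -> K <= M -> 0 < x -> x <= y -> y <= z ->
  x + y < K + L -> z <= M + J ->
  Num.sqrt 2 - 1 / 2 < J / x + (L - J) / y + (M - L) / z.
Proof.
move=> J0 JL LK KM x0 xy yz xyKL zMJ.
have y0 : 0 < y by lra.
have z0 : 0 < z by lra.
(* merge the last two blocks, at deadline z *)
have [KJy|yKJ] := leP (K + J) y.
  apply: (@lt_le_trans _ _ (J / x + (M - J) / z)).
    by apply: two_block_density => //; lra.
  have h : (L - J) / z <= (L - J) / y by apply: ler_wpM2l; [lra | rewrite lef_pV2].
  have : (M - J) / z = (L - J) / z + (M - L) / z by rewrite -mulrDl; congr (_ / _); ring.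
  lra.
(* Since [(M - L) / (M + J)] increases with [M], the last block may be shrunk to [K - L] tasks of
   deadline [K + J]. *)
have h1 : (K - L) / (K + J) <= (M - L) / z.
  apply: (@le_trans _ _ ((M - L) / (M + J))).
    rewrite ler_pdivrMr; last lra.
    rewrite mulrAC ler_pdivlMr; last lra.
    nra.
  by apply: ler_wpM2l; [lra | rewrite lef_pV2 // posrE; lra].
have [J2y|yJ2] := leP (2 * J) y.
  have KJ : 0 < K - J by lra.
  (* The mean deadline of the last two blocks. The case [2 * J <= y] gives [v - y <= K - L], hence
     [x + v < 2 * K], as the two-block bound requires. *)
  set v := ((L - J) * y + (K - L) * (K + J)) / (K - J).
  have vE : v * (K - J) = (L - J) * y + (K - L) * (K + J).
    by rewrite /v divfK // lt0r_neq0.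
  have yv : y <= v by rewrite -(ler_pM2r KJ) vE; nra.
  have vKJ : v <= K + J by rewrite -(ler_pM2r KJ) vE; nra.
  have vK : v - y <= K - L.
    rewrite -(ler_pM2r KJ) mulrBl vE.
    have : 0 <= (K - L) * (y - 2 * J) by apply: mulr_ge0; lra.
    lra.
  have v0 : 0 < v by lra.
  (* Jensen for 1/t with weights L - J and K - L *)
  have h2 : (K - J) / v <= (L - J) / y + (K - L) / (K + J).
    have tangent t : 0 < t -> 2 / v - t / v ^+ 2 <= t^-1.
      move=> t0; rewrite -subr_ge0.
      have -> : t^-1 - (2 / v - t / v ^+ 2) = (t - v) ^+ 2 / (t * v ^+ 2).
        by field; rewrite !lt0r_neq0.
      by rewrite divr_ge0 ?sqr_ge0 // mulr_ge0 ?sqr_ge0 // ltW.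
    have a1 : (L - J) * (2 / v - y / v ^+ 2) <= (L - J) / y.
      by apply: ler_wpM2l; [lra | exact: tangent].
    have a2 : (K - L) * (2 / v - (K + J) / v ^+ 2) <= (K - L) / (K + J).
      by apply: ler_wpM2l; [lra | apply: tangent; lra].
    have : (L - J) * (2 / v - y / v ^+ 2) + (K - L) * (2 / v - (K + J) / v ^+ 2)
        = (K - J) * 2 / v - ((L - J) * y + (K - L) * (K + J)) / v ^+ 2.
      by field; rewrite lt0r_neq0.
    rewrite -vE.
    have -> : (K - J) * 2 / v - v * (K - J) / v ^+ 2 = (K - J) / v.
      by field; rewrite lt0r_neq0.
    lra.
  have : Num.sqrt 2 - 1 / 2 < J / x + (K - J) / v.
    by apply: two_block_density => //; lra.
  lra.
(* In the remaining case [y < 2 * J] the density is at least 1. *)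
apply: (lt_le_trans (sqrt2_sub_half_lt1 R)).
have iyx : y^-1 <= x^-1 by rewrite lef_pV2.
have h3 : 0 <= (K - L) / (K + J) by apply: divr_ge0; lra.
have [yL|Ly] := leP y L.
  have : 1 <= L / y by rewrite ler_pdivlMr // mul1r.
  have : J / y <= J / x by rewrite ler_pM2l.
  have : J / y + (L - J) / y = L / y by rewrite -mulrDl addrC subrK.
  lra.
(* Now [J > L / 2], so moving weight from [1 / x] to [1 / y] until both are [L / 2] only lowers the
   sum. *)
have h4 : L / 2 * (x^-1 + y^-1) <= J / x + (L - J) / y.
  have : 0 <= (J - L / 2) * (x^-1 - y^-1) by apply: mulr_ge0; lra.
  lra.
have h5 : 4 / (K + L) <= x^-1 + y^-1.
  have -> : x^-1 + y^-1 = (x + y) / (x * y) by field; rewrite !lt0r_neq0.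
  rewrite ler_pdivrMr; last lra.
  rewrite mulrAC ler_pdivlMr; last exact: mulr_gt0.
  have : 0 <= (x - y) ^+ 2 by exact: sqr_ge0.
  nra.
have h6 : L / 2 * (4 / (K + L)) <= L / 2 * (x^-1 + y^-1).
  by apply: ler_wpM2l; lra.
have h7 : (K - L) / (K + L) <= (K - L) / (K + J).
  by apply: ler_wpM2l; [lra | rewrite lef_pV2 ?posrE; lra].
have : L / 2 * (4 / (K + L)) + (K - L) / (K + L) = 1.
  by field; rewrite lt0r_neq0 //; lra.
lra.
Qed.

(** * Slots for sorted deadlines of low density *)

Lemma block_density (R : realType) (e : nat -> nat) (i j D : nat) :
  (i <= j)%N -> (forall k, (i <= k < j)%N -> (0 < e k <= D)%N) ->
  (j%:R - i%:R) / D%:R <= \sum_(i <= k < j) (e k)%:R^-1 :> R.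
Proof.
move=> ij he; rewrite -natrB // mulr_natl -sumr_const_nat.
rewrite big_nat_cond [leRHS]big_nat_cond; apply: ler_sum => k /andP[/he /andP[e0 eD] _].
by rewrite lef_pV2 ?posrE ?ltr0n ?ler_nat //; lia.
Qed.

Lemma sorted_slots (R : realType) (n : nat) (e : nat -> nat) :
  (forall k, (k < n)%N -> (0 < e k)%N) ->
  (forall i j, (i <= j)%N -> (j < n)%N -> (e i <= e j)%N) ->
  \sum_(0 <= k < n) (e k)%:R^-1 <= Num.sqrt 2 - 1 / 2 :> R ->
  exists p q : nat -> nat,
    (forall i j, (i < n)%N -> (j < n)%N ->
       [/\ p i = p j -> i = j, q i = q j -> i = j & p i <> q j]) /\
    (forall k, (k < n)%N -> [/\ (0 < p k <= e k)%N & (0 < q k <= p k + e k)%N]).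
Proof.
move=> e0 emono dens.
have prefix m : (m <= n)%N ->
    \sum_(0 <= k < m) (e k)%:R^-1 <= \sum_(0 <= k < n) (e k)%:R^-1 :> R.
  by move=> mn; rewrite [leRHS](big_cat_nat (n := m)) //= lerDl sumr_ge0 // => k _; rewrite invr_ge0.
have eD i j m : (j <= m)%N -> (m <= n)%N ->
    forall k, (i <= k < j)%N -> (0 < e k <= e m.-1)%N.
  by move=> jm mn k kij; have := e0 k; have := emono k m.-1; lia.
(* Otherwise the first [k + 1] tasks have deadlines at most [k] and density above 1. *)
have ltke k : (k < n)%N -> (k < e k)%N.
  move=> kn; rewrite ltnNge; apply/negP => ek.
  have := @block_density R e 0 k.+1 (e k) isT (eD _ _ k.+1 (leqnn _) kn).
  have := prefix _ kn; rewrite subr0.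
  have : 1 <= k.+1%:R / (e k)%:R :> R.
    by rewrite ler_pdivlMr ?mul1r ?ler_nat ?ltr0n ?e0 //; lia.
  have := sqrt2_sub_half_lt1 R; lra.
have [p [plt p0 low tight]] := latest_slots n e ltke.
have room j : (j < n)%N ->
    (j.+1 + \sum_(k < n | p k <= p j + e j) 1 <= p j + e j)%N.
  move=> jn; rewrite leqNgt; apply/negP; set t := (p j + e j)%N => over.
  (* All tasks counted in [over] have index at most [k], so the count is at most [k + 1] and [over]
     becomes an inequality on [t]. *)
  have [k pk kmax] : exists2 k : 'I_n, (p k <= t)%N &
      forall i : 'I_n, (p i <= t)%N -> (i <= k)%N.
    case: (@arg_maxnP _ (Ordinal jn) (fun i => p i <= t)%N val) => /=; first by rewrite /t; lia.
    by move=> k; exists k.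
  have jk : (j <= k)%N by apply: (kmax (Ordinal jn)); rewrite /= /t; lia.
  have kn := ltn_ord k.
  have {}over : (t <= j + k + 1)%N.
    suff : (\sum_(i < n | p i <= t) 1 <= k.+1)%N by lia.
    have <- : (\sum_(i < k.+1) 1 = k.+1)%N by rewrite sum_nat_const card_ord muln1.
    rewrite [leqRHS](big_ord_widen n (fun=> 1%N)) //.
    rewrite big_mkcond [leqRHS]big_mkcond /=; apply: leq_sum => i _.
    by case: ifP => // /kmax; rewrite ltnS => ->.
  (* Substituting [p j = e l - (l - j)] into [over] bounds [e j + e l]. An index [m] tight for [k]
     and [p k <= t] bound [e m]. Block sizes are the successors of these indices. *)
  have [l ljn tl] := tight j jn.
  have [m [K [JL LK KM mn [xy zM]]]] : exists m K,
      [/\ (j <= l)%N, (l <= K)%N, (K <= m)%N, (m < n)%N &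
          (e j + e l <= K + l + 1)%N /\ (e m <= m + j + 1)%N].
    have [m kmn tm] := tight k kn.
    have lowj := low j m; have lowk := low k l.
    (* if k < l, then k and l lie in the same block of consecutive slots, so l can
       serve as m *)
    have [lk|kl] := leqP l k.
      by exists m, (nat_of_ord k); split=> //; try split; rewrite /t in over pk; lia.
    by exists l, l; split=> //; try split; rewrite /t in over pk; lia.
  have := @three_block_density R j.+1%:R l.+1%:R K.+1%:R m.+1%:R
    (e j)%:R (e l)%:R (e m)%:R.
  rewrite -!natrD !ler_nat !ltr_nat !ltr0n.
  have ejl := emono j l; have elm := emono l m; have ej0 := e0 j jn.
  move=> /(_ isT) /(_ ltac:(lia)) /(_ ltac:(lia)) /(_ ltac:(lia)) /(_ ltac:(lia)).
  move=> /(_ ltac:(lia)) /(_ ltac:(lia)) /(_ ltac:(lia)) /(_ ltac:(lia)).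
  have := prefix m.+1 mn.
  rewrite (big_cat_nat (n := j.+1)) //=; last by lia.
  rewrite [X in _ + X <= _](big_cat_nat (n := l.+1)) //=; last by lia.
  have b1 := @block_density R e 0 j.+1 (e j) isT (eD _ _ j.+1 (leqnn _) jn).
  have b2 := @block_density R e j.+1 l.+1 (e l) ltac:(lia) (eD _ _ l.+1 (leqnn _) ltac:(lia)).
  have b3 := @block_density R e l.+1 m.+1 (e m) ltac:(lia) (eD _ _ m.+1 (leqnn _) mn).
  move: b1; rewrite subr0; lra.
have [q [qinj pq q0 qe]] := @idle_slots n p (fun j => p j + e j)%N p0 room.
exists p, q; split=> [i j iN jN|k kn].
  split; [|exact: qinj|by apply/eqP; apply: pq].
  by have := plt i j; have := plt j i; lia.
rewrite p0 // q0 // qe //; split=> //.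
by have := low k k; lia.
Qed.

Lemma low_density_schedulable (R : realType) (n : nat) (d : 'I_n -> nat) :
  two_visits_instance d -> density R d <= Num.sqrt 2 - 1 / 2 -> schedulable d.
Proof.
move=> d0 dens.
pose r := sort (relpre d leq) (enum 'I_n).
have sr : size r = n by rewrite size_sort size_enum_ord.
have rE i : i \in r by rewrite mem_sort mem_enum.
have ri i : (index i r < n)%N by rewrite -{2}sr index_mem.
pose e := nth 0%N (map d r).
have de i : e (index i r) = d i by rewrite /e (nth_map i) ?sr // nth_index.
have e0 k : (k < n)%N -> (0 < e k)%N.
  move=> kn; have : e k \in map d r by rewrite mem_nth // size_map sr.
  by case/mapP => i _ ->; apply: d0.
have emono i j : (i <= j)%N -> (j < n)%N -> (e i <= e j)%N.
  move=> ij jn; apply: (sorted_leq_nth leq_trans leqnn) => //.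
  - by rewrite sorted_map sort_sorted // => x y; apply: leq_total.
  - by rewrite inE size_map sr; lia.
  - by rewrite inE size_map sr.
have dE : \sum_(0 <= k < n) (e k)%:R^-1 = density R d.
  rewrite /density -big_enum (perm_big r) 1?perm_sym ?perm_sort //=
    -(big_map d xpredT (fun x => x%:R^-1)).
  by rewrite [RHS](big_nth 0%N) size_map sr.
rewrite -dE in dens.
have [p [q [inj bnd]]] := sorted_slots R n e e0 emono dens.
have iinj i j : index i r = index j r -> i = j.
  by move=> E; rewrite -(nth_index i (rE i)) E nth_index.
(* The predecessors turn slots counted from 1 into slots counted from 0. *)
apply: (@schedulable_slots n d (fun i => (p (index i r)).-1) (fun i => (q (index i r)).-1)).
- move=> i j E; apply: iinj; have [h _ _] := inj _ _ (ri i) (ri j); apply: h.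
  by have [] := bnd _ (ri i); have [] := bnd _ (ri j); lia.
- move=> i j E; apply: iinj; have [_ h _] := inj _ _ (ri i) (ri j); apply: h.
  by have [] := bnd _ (ri i); have [] := bnd _ (ri j); lia.
- move=> i j; have [_ _] := inj _ _ (ri i) (ri j).
  by have [] := bnd _ (ri i); have [] := bnd _ (ri j); lia.
- by move=> i; have [] := bnd _ (ri i); rewrite de; lia.
- by move=> i; have [] := bnd _ (ri i); rewrite de; lia.
Qed.

(** * The upper bound and the threshold *)

Lemma equal_deadlines_unschedulable (m : nat) :
  ~ schedulable (fun _ : 'I_m.+1 => m).
Proof.
move=> [s [_ c2 fv _]].
have f_lt i : (index i s < m)%N by exact: fv.
have sE i : i \in s by rewrite -has_pred1 has_count c2.
have finj : injective (fun i => Ordinal (f_lt i)).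
  by move=> i j [E]; rewrite -(nth_index i (sE i)) E nth_index.
by have := leq_card _ finj; rewrite !card_ord ltnn.
Qed.

Lemma guarantees_schedule_le1 (R : realType) (delta : R) :
  guarantees_schedule delta -> delta <= 1.
Proof.
move=> g; rewrite leNgt; apply/negP => d1.
have d10 : 0 < delta - 1 by rewrite subr_gt0.
(* Chosen so that [1 / m <= delta - 1], which keeps the density [1 + 1 / m] within [delta]. *)
pose m := (Num.truncn (delta - 1)^-1).+1.
apply: (@equal_deadlines_unschedulable m); apply: g => //.
rewrite /density sumr_const card_ord mulrS.
have -> : m%:R^-1 *+ m = 1 :> R by rewrite -(mulr_natr (m%:R^-1)) mulVf ?pnatr_eq0.
have : (m%:R)^-1 <= delta - 1.
  rewrite -[leRHS]invrK lef_pV2 ?posrE ?invr_gt0 ?ltr0n //.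
  by apply: ltW; apply: truncnS_gt.
lra.
Qed.

Theorem theorem11 (R : realType) :
  (forall (n : nat) (d : 'I_n -> nat), two_visits_instance d ->
     density R d <= Num.sqrt 2 - 1 / 2 -> schedulable d)
  /\ Num.sqrt 2 - 1 / 2 <= lower_density_threshold R
  /\ lower_density_threshold R <= 1
  /\ (forall delta : R, guarantees_schedule delta -> delta <= 1).
Proof.
have low := @low_density_schedulable R.
have mem : [set delta : R | guarantees_schedule delta]%classic (Num.sqrt 2 - 1 / 2) by [].
split=> //; split; last split.
(* The upper bound 1 ensures that [sup] is a genuine supremum, not its default value. *)
- by apply: ub_le_sup mem; exists 1 => delta; apply: guarantees_schedule_le1.
- by apply: ge_sup; [exists (Num.sqrt 2 - 1 / 2) | move=> delta; apply: guarantees_schedule_le1].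
- exact: guarantees_schedule_le1.
Qed.
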